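(* Let $J\colon\mathcal S_n\to\mathbb R$ be strictly isotone, continuous and spectrally unbounded on $\mathcal P_n$, and let Assumption (A1) hold. Then problem (CI) has a solution.
   Context: $n,p_1,p_2$ are positive integers, $p_1,p_2\le n$, $H_1\in\mathbb R^{p_1\times n}$, $H_2\in\mathbb R^{p_2\times n}$, $H=\begin{pmatrix}H_1\\H_2\end{pmatrix}$. Assumption (A1): $\mathrm{rk}(H_1)=p_1$, $\mathrm{rk}(H_2)=p_2$, $\mathrm{rk}(H)=n$ (and the two input estimators $\hat x_1,\hat x_2$ are unbiased estimators of $H_1x_{\rm true}$, $H_2x_{\rm true}$; in the deterministic maps below only their values enter). $\mathcal S_m,\mathcal P_m,\mathcal P_m^\succ$: real symmetric, positive semi-definite, positive definite $m\times m$ matrices; $\preceq$ is the Löwner order. $\mathcal D_F:=\mathbb R^{p_1}\times\mathbb R^{p_2}\times\mathcal P_{p_1}^\succ\times\mathcal P_{p_2}^\succ$, with points denoted $(\hat x_1,\hat x_2,\hat P_1,\hat P_2)$. $J$ is strictly isotone if $A\preceq B$ implies $J(A)\le J(B)$ and ($A\preceq B$, $A\ne B$) implies $J(A)<J(B)$, for all $A,B\in\mathcal S_n$. $J$ is spectrally unbounded on $\mathcal P_n$ if $\lim_{k\to\infty}J(P_k)=+\infty$ for every sequence $(P_k)_{k\in\mathbb N}$ in $\mathcal P_n$ with $\lim_{k\to\infty}\lambda_{\max}(P_k)=+\infty$, where $\lambda_{\max}$ denotes the largest eigenvalue. Extend $J$ to $\bar J\colon\mathcal S_n\cup\{+\infty\}\to\mathbb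 R\cup\{+\infty\}$ by $\bar J(+\infty)=+\infty$ and $\bar J=J$ on $\mathcal S_n$, and set $P^{-1}:=+\infty$ for singular $P\in\mathcal P_n$. Problem (CI): a solution is a function $\boldsymbol\alpha^\ast\colon\mathcal D_F\to[0,1]$ such that at every point of $\mathcal D_F$ and for every function $\boldsymbol\alpha\colon\mathcal D_F\to[0,1]$, $\bar J((\boldsymbol\alpha^\ast H_1^\top\hat P_1^{-1}H_1+(1-\boldsymbol\alpha^\ast)H_2^\top\hat P_2^{-1}H_2)^{-1})\le\bar J((\boldsymbol\alpha H_1^\top\hat P_1^{-1}H_1+(1-\boldsymbol\alpha)H_2^\top\hat P_2^{-1}H_2)^{-1})$. *)

(* Defs.v *)
(* MathComp / MathComp-Analysis; the reals are an arbitrary [R : realType]. *)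
From HB Require Import structures.
From mathcomp Require Import all_boot all_order all_algebra.
From mathcomp Require Import all_classical all_reals all_analysis.

Set Implicit Arguments.
Unset Strict Implicit.
Unset Printing Implicit Defensive.

Import Order.TTheory GRing.Theory Num.Theory.
Import numFieldNormedType.Exports.

Local Open Scope classical_set_scope.
Local Open Scope ring_scope.

Section matrix_sets.
Context {R : realType} {m : nat}.

Definition symS : set 'M[R]_m := [set A | A \is symmetricmx].

Definition psdS : set 'M[R]_m :=
  [set A | symS A /\ forall x : 'cV[R]_m, 0 <= (x^T *m A *m x) 0 0].

Definition pdS : set 'M[R]_m :=
  [set A | symS A /\ forall x : 'cV[R]_m, x != 0 -> 0 < (x^T *m A *m x) 0 0].

Definition loewner_le (A B : 'M[R]_m) : Prop := psdS (B - A).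

(* A supremum, attained on symmetric matrices of positive size: their set of
   real eigenvalues is finite and nonempty. *)
Definition lambda_max (A : 'M[R]_m) : R := sup [set a : R | eigenvalue A a].

End matrix_sets.

(* A cost defined on the symmetric matrices only is represented by a function
   on all square matrices whose values outside [symS] are never used. *)
Section cost.
Context {R : realType} {n : nat}.
Implicit Types J : 'M[R]_n -> R.

Definition strictly_isotone J : Prop :=
  forall A B, symS A -> symS B -> loewner_le A B ->
    J A <= J B /\ (A <> B -> J A < J B).

Definition spectrally_unbounded J : Prop :=
  forall P : nat -> 'M[R]_n, (forall k, psdS (P k)) ->
    lambda_max (P k) @[k --> \oo] --> +oo ->
    J (P k) @[k --> \oo] --> +oo.

(* [None] plays the role of the added point +oo of the matrix space. *)
Definition ext_inv (P : 'M[R]_n) : option 'M[R]_n :=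
  if P \in unitmx then Some (invmx P) else None.

Definition ext_cost J (P : option 'M[R]_n) : \bar R :=
  if P is Some A then (J A)%:E else +oo%E.

End cost.

Section fusion.
Context {R : realType} {n p1 p2 : nat}.
Variables (H1 : 'M[R]_(p1, n)) (H2 : 'M[R]_(p2, n)).

(* Unbiasedness of the input estimators is not recorded: only their values
   appear in the problem. *)
Definition rank_assumption : Prop :=
  [/\ \rank H1 = p1, \rank H2 = p2 & \rank (col_mx H1 H2) = n].

Definition fusion_point : Type :=
  ('cV[R]_p1 * 'cV[R]_p2 * 'M[R]_p1 * 'M[R]_p2)%type.

Definition fusion_dom : set fusion_point :=
  [set d | let: (x1, x2, P1, P2) := d in pdS P1 /\ pdS P2].

Definition CI_info (a : R) (d : fusion_point) : 'M[R]_n :=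
  let: (x1, x2, P1, P2) := d in
  a *: (H1^T *m invmx P1 *m H1) + (1 - a) *: (H2^T *m invmx P2 *m H2).

Definition CI_solution (J : 'M[R]_n -> R) (astar : fusion_point -> R) : Prop :=
  set_fun fusion_dom `[0, 1] astar /\
  forall d, fusion_dom d ->
  forall alpha : fusion_point -> R, set_fun fusion_dom `[0, 1] alpha ->
    (ext_cost J (ext_inv (CI_info (astar d) d)) <=
     ext_cost J (ext_inv (CI_info (alpha d) d)))%E.

End fusion.

(* Main.v *)
Require Import Defs.
From HB Require Import structures.
From mathcomp Require Import all_boot all_order all_algebra.
From mathcomp Require Import complex.
From mathcomp Require Import all_classical all_reals all_analysis.

Set Implicit Arguments.
Unset Strict Implicit.
Unset Printing Implicit Defensive.

Import Order.TTheory GRing.Theory Num.Theory.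
Import numFieldNormedType.Exports.

Local Open Scope classical_set_scope.
Local Open Scope ring_scope.

(** Fix the input data [d] and let C(a) be the information matrix at the weight
a in the unit interval. The weights may be optimized separately for every [d],
so it suffices to minimize a |-> J(C(a)^-1) over the unit interval, with value
+oo where C(a) is singular; the function of [d] is then obtained by choice.

At interior weights C(a) is positive definite: its kernel lies in the kernels
of both [H1] and [H2], so that the rank condition makes it trivial
([unit_CI_info]); hence the cost is finite at a = 1/2. At the endpoints C(a) may
be singular. The point of the proof is that the cost blows up there: if a_k
tends to a and C(a) is singular, then det C(a_k) tends to 0, so det C(a_k)^-1
tends to infinity. The determinant of a positive semidefinite matrix is the
product of its n eigenvalues and is thus at most the n-th power of the largest
one ([psd_norm_det_le], from the spectral theorem), so the largest eigenvalue
of C(a_k)^-1 tends to infinity and spectral unboundedness applies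
([cost_cvgy_at_singular]).

Consequently the set of weights whose cost is at most that of a = 1/2 is closed
in the unit interval, hence compact, and contains only weights with C(a)
invertible. On it the cost is continuous, since inversion is, and the extreme
value theorem gives a minimizer ([inverse_cost_minimizer]). *)

(** * Characteristic polynomials and spectra of symmetric matrices *)

Lemma char_poly_conj (F : fieldType) (n : nat) (P D : 'M[F]_n) :
  P \in unitmx -> char_poly (invmx P *m D *m P) = char_poly D.
Proof.
move=> Pu; rewrite /char_poly.
(* X is scalar, hence commutes with P: conjugation only affects D. *)
have -> : char_poly_mx (invmx P *m D *m P) =
    map_mx polyC (invmx P) *m char_poly_mx D *m map_mx polyC P.
  rewrite /char_poly_mx mulmxBr mulmxBl !map_mxM /=.
  congr (_ - _); rewrite scalar_mxC -mulmxA -map_mxM mulVmx //.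
  by rewrite map_mx1 mulmx1.
rewrite !det_mulmx mulrC mulrA -det_mulmx -map_mxM mulmxV //.
by rewrite map_mx1 det1 mul1r.
Qed.

(** The spectral theorem is used over the algebraic closure R[i]: a real
symmetric matrix is hermitian there, hence unitarily diagonalizable with a real
diagonal, and the factorization of its characteristic polynomial descends to R
because the embedding of R in R[i] is injective on polynomials. *)
Lemma char_poly_symmetric_split (R : rcfType) (n : nat) (A : 'M[R]_n) :
  A \is symmetricmx ->
  exists r : 'I_n -> R, char_poly A = \prod_i ('X - (r i)%:P).
Proof.
move=> Asym; pose C : numClosedFieldType := R[i].
pose toC : {rmorphism R -> C} := real_complex R.
have ACherm : (map_mx toC A : 'M[C]_n) \is hermsymmx.
  apply: realsym_hermsym.
    apply/is_hermitianmxP; rewrite expr0 scale1r map_mx_id //.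
    move/is_hermitianmxP: Asym; rewrite expr0 scale1r map_mx_id // => {1}->.
    by rewrite map_trmx.
  by apply/mxOverP => i j; rewrite mxE; apply/complex_realP; exists (A i j).
have /hermitian_normalmx /orthomx_spectralP := ACherm.
have /mxOverP := hermitian_spectral_diag_real ACherm.
set D := spectral_diag _; set P := spectralmx _ => Dreal AE.
exists (fun i => complex.Re (D 0 i)).
apply: (map_poly_inj toC).
rewrite map_char_poly AE char_poly_conj ?spectral_unit //.
rewrite char_poly_trig ?diag_mx_is_trig // rmorph_prod; apply: eq_bigr => i _.
rewrite rmorphB /= map_polyX map_polyC /= mxE eqxx mulr1n.
by rewrite RRe_real.
Qed.

(** The two consequences of the splitting that matter here: the determinant is a
product of eigenvalues, and there are only finitely many eigenvalues, so that
the supremum defining [lambda_max] is an upper bound. *)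
Lemma symmetric_spectrum (R : rcfType) (n : nat) (A : 'M[R]_n) :
  A \is symmetricmx ->
  exists2 r : 'I_n -> R, \det A = \prod_i r i &
    forall a, eigenvalue A a <-> exists i, a = r i.
Proof.
move=> /char_poly_symmetric_split[r Ar]; exists r.
  have := char_poly_det A; rewrite Ar -horner_coef0 horner_prod.
  under eq_bigr do rewrite hornerXsubC sub0r -mulN1r.
  rewrite big_split /= prodr_const card_ord => /mulfI -> //.
  by rewrite signr_eq0.
move=> a; rewrite eigenvalue_root_char Ar rootE horner_prod; split.
  move=> /prodf_eq0[i _]; rewrite hornerXsubC subr_eq0 => /eqP ->.
  by exists i.
by move=> [i ->]; apply/prodf_eq0; exists i; rewrite // hornerXsubC subrr.
Qed.

Lemma eigenvalue_le_lambda_max (R : realType) (n : nat) (A : 'M[R]_n) (a : R) :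
  symS A -> eigenvalue A a -> a <= lambda_max A.
Proof.
move=> /symmetric_spectrum[r _ Ar] Aa.
apply: ub_le_sup => //; exists (\sum_j `|r j|) => b /Ar[j ->].
by rewrite (bigD1 j) //= (le_trans (ler_norm _)) // lerDl sumr_ge0.
Qed.

(** * Positive semidefinite and positive definite matrices *)

Lemma symS_trmxP (R : realType) (n : nat) (A : 'M[R]_n) :
  symS A <-> A^T = A.
Proof.
split=> [/is_hermitianmxP|AT].
  by rewrite expr0 scale1r map_mx_id // => <-.
by apply/is_hermitianmxP; rewrite expr0 scale1r map_mx_id.
Qed.

Lemma symS_invmx (R : realType) (n : nat) (A : 'M[R]_n) :
  symS A -> symS (invmx A).
Proof. by move=> /symS_trmxP AT; apply/symS_trmxP; rewrite trmx_inv AT. Qed.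

Lemma psd_invmx (R : realType) (n : nat) (P : 'M[R]_n) :
  P \in unitmx -> psdS P -> psdS (invmx P).
Proof.
move=> Pu [Psym Ppos]; have Vsym := symS_invmx Psym; split=> // x.
have := Ppos (invmx P *m x); move/symS_trmxP: Vsym => Vsym.
by rewrite trmx_mul Vsym -!mulmxA (mulmxA P) mulmxV // mul1mx mulmxA.
Qed.

Lemma psd_eigenvalue_ge0 (R : realType) (n : nat) (P : 'M[R]_n) (a : R) :
  psdS P -> eigenvalue P a -> 0 <= a.
Proof.
move=> [_ Ppos] /eigenvalueP[v vP v0].
have /= := Ppos v^T; rewrite trmxK vP -scalemxAl mxE mxE.
(* v P v^T = a v v^T, and v v^T > 0. *)
suff: 0 < \sum_j v 0 j * v^T j 0 by move=> h; rewrite pmulr_lge0.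
have [j vj] : exists j, v 0 j != 0.
  apply/existsP; apply: contraR v0; rewrite negb_exists => /forallP v0.
  by apply/eqP/rowP => j; have := v0 j; rewrite negbK mxE => /eqP.
rewrite (bigD1 j) //= ltr_pwDl ?mxE -?expr2 ?exprn_even_gt0 //.
by apply: sumr_ge0 => k _; rewrite mxE -expr2 sqr_ge0.
Qed.

Lemma psd_lambda_max_ge0 (R : realType) (n : nat) (P : 'M[R]_n) :
  psdS P -> 0 <= lambda_max P.
Proof.
move=> Ppsd; have [[a Pa]|noeig] := pselect (exists a, eigenvalue P a).
  apply: le_trans (psd_eigenvalue_ge0 Ppsd Pa) _.
  by case: Ppsd => Psym _; exact: eigenvalue_le_lambda_max.
(* Without eigenvalues the supremum takes its default value 0. *)
by rewrite /lambda_max sup_out // => -[[a Pa] _]; apply: noeig; exists a.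
Qed.

(** The link between invertibility and the largest eigenvalue: each of the [n]
eigenvalues is between 0 and [lambda_max P]. It replaces any information about
eigenvectors: a large determinant forces a large eigenvalue. *)
Lemma psd_norm_det_le (R : realType) (n : nat) (P : 'M[R]_n) :
  psdS P -> `|\det P| <= lambda_max P ^+ n.
Proof.
move=> Ppsd; have [Psym _] := Ppsd.
have [r -> Pr] := symmetric_spectrum Psym.
rewrite normr_prod -[X in _ ^+ X](card_ord n) -prodr_const.
apply: ler_prod => i _; have ei : eigenvalue P (r i) by apply/Pr; exists i.
rewrite normr_ge0 ger0_norm ?(psd_eigenvalue_ge0 Ppsd ei) //.
exact: eigenvalue_le_lambda_max.
Qed.

(** A vector of the left kernel annihilates the form. *)
Lemma definite_unitmx (F : fieldType) (n : nat) (A : 'M[F]_n) :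
  (forall x : 'cV[F]_n, (x^T *m A *m x) 0 0 = 0 -> x = 0) -> A \in unitmx.
Proof.
move=> Adef; rewrite -row_free_unit -kermx_eq0; apply/eqP/row_matrixP => i.
apply: trmx_inj; rewrite row0 trmx0; apply: Adef.
by rewrite trmxK -row_mul mulmx_ker row0 mul0mx mxE.
Qed.

Lemma pd_form_eq0 (R : realType) (n : nat) (P : 'M[R]_n) (x : 'cV[R]_n) :
  pdS P -> (x^T *m P *m x) 0 0 = 0 -> x = 0.
Proof.
move=> [_ Ppos] Px; apply/eqP; apply: contraTT isT => /Ppos.
by rewrite Px ltxx.
Qed.

Lemma pd_unitmx (R : realType) (n : nat) (P : 'M[R]_n) :
  pdS P -> P \in unitmx.
Proof. by move=> Ppd; apply: definite_unitmx => x; exact: pd_form_eq0. Qed.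

Lemma pd_psd (R : realType) (n : nat) (P : 'M[R]_n) : pdS P -> psdS P.
Proof.
move=> [Psym Ppos]; split=> // x; have [->|/Ppos/ltW //] := eqVneq x 0.
by rewrite mulmx0 mxE.
Qed.

Lemma pd_invmx (R : realType) (n : nat) (P : 'M[R]_n) :
  pdS P -> pdS (invmx P).
Proof.
move=> Ppd; have Pu := pd_unitmx Ppd.
have [Vsym Vge0] := psd_invmx Pu (pd_psd Ppd); split=> // x x0.
rewrite lt_def Vge0 andbT; apply: contra_neq x0 => Vx.
(* x = P y with y = P^-1 x, and the form of P at y is that of P^-1 at x. *)
rewrite -[x](mulKVmx Pu) [invmx P *m x](pd_form_eq0 Ppd) ?mulmx0 //.
rewrite trmx_mul; move/symS_trmxP: Vsym => ->.
by rewrite -!mulmxA (mulmxA P) mulmxV // mul1mx mulmxA.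
Qed.

Lemma psd_congruence (R : realType) (m n : nat) (S : 'M[R]_m)
    (H : 'M[R]_(m, n)) : psdS S -> psdS (H^T *m S *m H).
Proof.
move=> [Ssym Spos]; split=> [|x]; last first.
  by have := Spos (H *m x); rewrite trmx_mul !mulmxA.
apply/symS_trmxP; move/symS_trmxP: Ssym => Ssym.
by rewrite !trmx_mul trmxK Ssym mulmxA.
Qed.

Lemma psd_comb (R : realType) (n : nat) (a b : R) (P Q : 'M[R]_n) :
  0 <= a -> 0 <= b -> psdS P -> psdS Q -> psdS (a *: P + b *: Q).
Proof.
move=> a0 b0 [/symS_trmxP Psym Ppos] [/symS_trmxP Qsym Qpos]; split=> [|x].
  by apply/symS_trmxP; rewrite linearD !linearZ /= Psym Qsym.
rewrite mulmxDr mulmxDl -!scalemxAr -!scalemxAl.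
rewrite mxE [X in X + _]mxE [X in _ + X]mxE.
by rewrite addr_ge0 ?mulr_ge0.
Qed.

(** * Limits of determinants and inverses *)

Lemma cvg_det (R : numFieldType) (n : nat) (T : Type) (F : set_system T)
    (M : T -> 'M[R]_n) (L : 'M[R]_n) : Filter F ->
  (forall i j, M t i j @[t --> F] --> L i j) ->
  \det (M t) @[t --> F] --> \det L.
Proof.
move=> FF ML; apply: (cvg_big (op := +%R)) => //; first exact: add_continuous.
move=> s _; apply: cvgM; first exact: cvg_cst.
by apply: (@cvg_big R^o _ *%R 1 xpredT mul_continuous _ F _ _ _ FF) => i _.
Qed.

(** The topology of matrices is the product topology of the finitely many
entries. *)
Lemma cvg_matrix (T : topologicalType) (m n : nat) (I : Type)
    (F : set_system I) (M : I -> 'M[T]_(m, n)) (L : 'M[T]_(m, n)) : Filter F ->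
  (forall i j, M t i j @[t --> F] --> L i j) -> M t @[t --> F] --> L.
Proof.
move=> FF ML A [P LP PA].
suff : \forall t \near F, forall ij, P ij.1 ij.2 (M t ij.1 ij.2).
  by apply: filterS => t Mt; apply: PA => i j; exact: (Mt (i, j)).
by apply: filter_forall => -[i j]; exact: ML.
Qed.

(** By Cramer's rule the entries of the inverse are cofactors divided by the
determinant; the matrices [M t] are invertible for [t] near the limit, as
the determinant of [L] is nonzero. *)
Lemma cvg_invmx (R : numFieldType) (n : nat) (T : Type) (F : set_system T)
    (M : T -> 'M[R]_n) (L : 'M[R]_n) : Filter F -> L \in unitmx ->
  (forall i j, M t i j @[t --> F] --> L i j) ->
  forall i j, invmx (M t) i j @[t --> F] --> invmx L i j.
Proof.
move=> FF Lu ML i j.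
have invE (A : 'M[R]_n) :
    A \in unitmx -> invmx A i j = (\det A)^-1 * cofactor A j i.
  by move=> Au; rewrite /invmx Au !mxE.
have detL : \det L != 0 by rewrite -unitfE -unitmxE.
rewrite invE //.
have nearE : \forall t \near F,
    (\det (M t))^-1 * cofactor (M t) j i = invmx (M t) i j.
  have := @cvgr_neq0 R R^o T F FF _ _ (cvg_det FF ML) detL.
  by apply: filterS => t detM; rewrite invE // unitmxE unitfE.
apply: (cvg_trans (near_eq_cvg nearE)).
apply: cvgM; first by apply: cvgV => //; exact: cvg_det.
apply: cvgM; first exact: cvg_cst.
apply: cvg_det => i' j'; rewrite !mxE.
by under eq_cvg do rewrite !mxE; exact: ML.
Qed.

(** Spectral unboundedness is a hypothesis on sequences, whence the need for the
sequential description of closed sets. *)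
Lemma closed_seq (R : realType) (A : set R) :
  (forall (u : nat -> R) (l : R),
     (forall k, A (u k)) -> u k @[k --> \oo] --> l -> A l) ->
  closed A.
Proof.
move=> Aseq l clAl.
have /choice[u uP] : forall k : nat, exists x, A x /\ ball l k.+1%:R^-1 x.
  move=> k; have [|x [Ax lx]] := clAl (ball l k.+1%:R^-1).
    by apply: nbhsx_ballx; rewrite invr_gt0.
  by exists x.
apply: (Aseq u) => [k|]; first by case: (uP k).
apply/cvgrPdist_lt => e e0; have := near_infty_natSinv_lt (PosNum e0).
by apply: filterS => k /= ke; apply: lt_trans ke; case: (uP k).
Qed.

(** * Minimizing the cost of an inverse along a compact family *)

(** As [det (C k)] tends to 0, [det (C k)^-1] is eventually larger than any
[B ^+ n], so by [psd_norm_det_le] the largest eigenvalue of [(C k)^-1] is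
eventually larger than any [B]. *)
Lemma cost_cvgy_at_singular (R : realType) (n : nat) (J : 'M[R]_n -> R)
    (C : nat -> 'M[R]_n) : (0 < n)%N ->
  spectrally_unbounded J ->
  (forall k, psdS (C k)) -> (forall k, C k \in unitmx) ->
  \det (C k) @[k --> \oo] --> (0 : R) ->
  J (invmx (C k)) @[k --> \oo] --> +oo.
Proof.
move=> n0 Junb Cpsd Cu detC.
have psdV k := psd_invmx (Cu k) (Cpsd k).
apply: Junb => //; apply/cvgryPge => A.
(* Raising B to the power n preserves the order only for B >= 0, and A may be
   negative. *)
pose B := Num.max A 1.
have B0 : 0 < B by rewrite /B lt_max ltr01 orbT.
have Bn : 0 < (B ^+ n)^-1 by rewrite invr_gt0 exprn_gt0.
have /cvgrPdist_lt/(_ _ Bn) := detC; apply: filterS => k /=.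
rewrite sub0r normrN => detk.
have detCk : 0 < `|\det (C k)| by rewrite normr_gt0 -unitfE -unitmxE.
have : B ^+ n <= lambda_max (invmx (C k)) ^+ n.
  apply: le_trans (psd_norm_det_le (psdV k)).
  by rewrite det_inv normfV -[leLHS]invrK lef_pV2 ?posrE // ltW.
rewrite ler_pXn2r ?nnegrE ?(ltW B0) ?psd_lambda_max_ge0 //.
by apply: le_trans; rewrite /B le_max lexx.
Qed.

(** [J] is only continuous relatively to the symmetric matrices, so the inverses
must converge inside that set; inversion preserves symmetry. *)
Lemma cvg_cost_invmx (R : realType) (n : nat) (J : 'M[R]_n -> R) (T : Type)
    (F : set_system T) (M : T -> 'M[R]_n) (L : 'M[R]_n) : Filter F ->
  {within symS, continuous J} ->
  (forall i j, M t i j @[t --> F] --> L i j) ->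
  (\forall t \near F, symS (M t)) -> symS L -> L \in unitmx ->
  J (invmx (M t)) @[t --> F] --> J (invmx L).
Proof.
move=> FF /subspace_continuousP Jc ML Msym Lsym Lu.
apply: (cvg_comp (fun t => invmx (M t)) J _ (Jc _ (symS_invmx Lsym))) => A LA.
have := cvg_matrix FF (cvg_invmx FF Lu ML) LA; apply: filterS2 Msym => t Mt.
by apply; exact: symS_invmx.
Qed.

(** The extended cost need not be continuous, since it is +oo at singular [C a],
but its sublevel set through the given finite value is compact: along a
convergent sequence of this set, either the limit is invertible and the bound
passes to the limit, or it is singular and the bound is contradicted by
[cost_cvgy_at_singular]. On the sublevel set the cost is finite and continuous,
hence attains its minimum, which is then global. *)
Lemma inverse_cost_minimizer (R : realType) (n : nat) (J : 'M[R]_n -> R)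
    (A : set R) (C : R -> 'M[R]_n) : (0 < n)%N ->
  {within symS, continuous J} -> spectrally_unbounded J ->
  compact A -> (forall i j, continuous (fun a => C a i j)) ->
  (forall a, A a -> psdS (C a)) -> (exists2 a, A a & C a \in unitmx) ->
  exists2 a, A a & forall b, A b ->
    (ext_cost J (ext_inv (C a)) <= ext_cost J (ext_inv (C b)))%E.
Proof.
move=> n0 Jc Junb Acpt Cc Cpsd [m Am Cm].
pose g a := J (invmx (C a)).
(* The sublevel set through m already contains every candidate minimizer. *)
pose K := [set a | [/\ A a, C a \in unitmx & g a <= g m]].
have Kcl : closed K.
  apply: closed_seq => u l Ku ul.
  have Al : A l.
    have Acl : closed A by exact: compact_closed Acpt.
    by apply: (closed_cvg A Acl _ l ul); apply: nearW => k; case: (Ku k).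
  have uC i j : C (u k) i j @[k --> \oo] --> C l i j.
    exact: (cvg_comp _ _ ul (Cc i j l)).
  have le_gm : \forall k \near \oo, g (u k) <= g m.
    by apply: nearW => k; case: (Ku k).
  have [Cl|Csing] := boolP (C l \in unitmx).
    split=> //; apply: (cvgr_to_le _ le_gm); apply: cvg_cost_invmx => //.
      by apply: nearW => k; case: (Ku k) => /Cpsd[].
    by case: (Cpsd l Al).
  (* A singular limit would send the cost along u to +oo, above g m. *)
  exfalso.
  have detl : \det (C l) = 0.
    by apply/eqP; apply: contraNT Csing; rewrite unitmxE unitfE.
  have : g (u k) @[k --> \oo] --> +oo.
    apply: cost_cvgy_at_singular => // [k|k|].
    - by case: (Ku k) => /Cpsd.
    - by case: (Ku k).
    - by rewrite -detl; exact: cvg_det.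
  move=> /cvgryPgt/(_ (g m)) gtm.
  have [k /=] := filter_ex (filterI gtm le_gm).
  by case; rewrite ltNge => /negP.
have Kcpt : compact K.
  by apply: (subclosed_compact Kcl Acpt) => a [].
have gc : {within K, continuous g}.
  apply/subspace_continuousP => a [Aa Ca _]; apply: cvg_cost_invmx => //.
  - move=> i j; apply: cvg_trans (Cc i j a); apply: cvg_app.
    exact: cvg_within.
  - by near=> b; have [/Cpsd[]] : K b by near: b; exact: withinT.
  - by case: (Cpsd a Aa).
have Km : K m by [].
have [a /set_mem[Aa Ca _] amin] := compact_EVT_min (ex_intro _ m Km) Kcpt gc.
exists a => // b Ab; rewrite /ext_inv Ca.
case: ifPn => Cb /=; last exact: leey.
rewrite lee_fin -/(g a) -/(g b).
have [gbm|/ltW gmb] := leP (g b) (g m).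
  by apply: amin; rewrite inE.
by apply: le_trans gmb; apply: amin; rewrite inE.
Unshelve. all: by end_near. Qed.

(** * The information matrix of covariance intersection *)

Lemma psd_CI_info (R : realType) (n p1 p2 : nat) (H1 : 'M[R]_(p1, n))
    (H2 : 'M[R]_(p2, n)) (a : R) (d : fusion_point) :
  0 <= a <= 1 -> fusion_dom d -> psdS (CI_info H1 H2 a d).
Proof.
move: d => [[[x1 x2] P1] P2] /andP[a0 a1] [pd1 pd2].
by apply: psd_comb; rewrite ?subr_ge0 //;
  exact/psd_congruence/pd_psd/pd_invmx.
Qed.

(** The kernel of the information matrix at an interior weight is the common
kernel of [H1] and [H2], which is trivial as the stacked matrix has full column
rank. *)
Lemma unit_CI_info (R : realType) (n p1 p2 : nat) (H1 : 'M[R]_(p1, n))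
    (H2 : 'M[R]_(p2, n)) (a : R) (d : fusion_point) :
  \rank (col_mx H1 H2) = n -> 0 < a < 1 -> fusion_dom d ->
  CI_info H1 H2 a d \in unitmx.
Proof.
move: d => [[[x1 x2] P1] P2] Hrank /andP[a0 a1] [/pd_invmx pd1 /pd_invmx pd2].
apply: definite_unitmx => x.
rewrite mulmxDr mulmxDl -!scalemxAr -!scalemxAl.
rewrite mxE [X in X + _]mxE [X in _ + X]mxE.
have form p (S : 'M[R]_p) (H : 'M[R]_(p, n)) :
    x^T *m (H^T *m S *m H) *m x = (H *m x)^T *m S *m (H *m x).
  by rewrite trmx_mul !mulmxA.
rewrite !form; have [_ ge1] := pd_psd pd1; have [_ ge2] := pd_psd pd2.
(* Both terms are nonnegative and both weights are positive, so a vanishing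
   sum forces H1 x = 0 and H2 x = 0. *)
move=> /eqP; rewrite paddr_eq0 ?mulr_ge0 ?subr_ge0 ?(ltW a0) ?(ltW a1) //.
rewrite !mulf_eq0 (gt_eqF a0) subr_eq0 (gt_eqF a1) /=.
move=> /andP[/eqP/(pd_form_eq0 pd1) H1x /eqP/(pd_form_eq0 pd2) H2x].
have Hx : col_mx H1 H2 *m x = 0 by rewrite mul_col_mx H1x H2x col_mx0.
apply/trmx_inj; rewrite trmx0.
have Hfree : row_free (col_mx H1 H2)^T.
  by rewrite -row_leq_rank mxrank_tr Hrank.
apply: (row_free_inj Hfree) => /=.
by rewrite mul0mx -trmx_mul Hx trmx0.
Qed.

Theorem theorem31 (R : realType) (n p1 p2 : nat)
    (n_gt0 : (0 < n)%N) (p1_gt0 : (0 < p1)%N) (p2_gt0 : (0 < p2)%N)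
    (p1_le_n : (p1 <= n)%N) (p2_le_n : (p2 <= n)%N)
    (H1 : 'M[R]_(p1, n)) (H2 : 'M[R]_(p2, n))
    (A1 : rank_assumption H1 H2)
    (J : 'M[R]_n -> R)
    (J_isotone : strictly_isotone J)
    (J_continuous : {within symS, continuous J})
    (J_unbounded : spectrally_unbounded J) :
  exists astar : fusion_point -> R, CI_solution H1 H2 J astar.
Proof.
have [_ _ Hrank] := A1.
have /choice[astar astarP] : forall d : @fusion_point R p1 p2, exists a,
    fusion_dom d -> `[0, 1]%classic a /\ forall b, `[0, 1]%classic b ->
    (ext_cost J (ext_inv (CI_info H1 H2 a d)) <=
     ext_cost J (ext_inv (CI_info H1 H2 b d)))%E.
  move=> d; have [dom|ndom] := pselect (fusion_dom d); last by exists 0.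
  have [||a||a Aa amin] := @inverse_cost_minimizer _ _ J `[0, 1]%classic
    (fun a => CI_info H1 H2 a d) n_gt0 J_continuous J_unbounded.
  - exact: segment_compact.
  - move=> i j; case: d {dom} => [[[x1 x2] P1] P2] /=.
    set S1 := H1^T *m _ *m _; set S2 := H2^T *m _ *m _.
    have -> : (fun a => (a *: S1 + (1 - a) *: S2) i j) =
              fun a => a * S1 i j + (1 - a) * S2 i j.
      by apply/funext => a; rewrite mxE [X in X + _]mxE [X in _ + X]mxE.
    move=> a; apply: cvgD; apply: cvgM; try exact: cvg_cst.
      exact: cvg_id.
    by apply: cvgB; [exact: cvg_cst|exact: cvg_id].
  - by rewrite /= in_itv /= => a01; exact: psd_CI_info.
  (* Any interior weight would do. *)
  - exists 2^-1.
      by rewrite /= in_itv /= invr_ge0 ler0n invf_le1 ?ler1n ?ltr0n.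
    by apply: unit_CI_info; rewrite // invr_gt0 ltr0n invf_lt1 ?ltr1n ?ltr0n.
  by exists a.
exists astar; split=> [d /astarP[] //|d dom alpha alpha01].
by have [_] := astarP d dom; apply; exact: alpha01.
Qed.
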